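(* Let $q$ be a prime power and let $W(3,q)$ be the symplectic generalized quadrangle defined by a non-degenerate symplectic (alternating) form on $\mathrm{PG}(3,q)$, with associated polarity $\perp$; let $\mathcal P$ and $\mathcal L$ be its sets of points and lines. Fix a point $P$ of $W(3,q)$ and let $\pi=P^\perp$, a plane of $\mathrm{PG}(3,q)$ (isomorphic to $\mathrm{PG}(2,q)$). Let $(\overline{\mathcal P}',\overline{\mathcal L}')$ be a $1$-good structure in the projective plane $\pi$, i.e. $\overline{\mathcal P}'$ is a set of points of $\pi$ and $\overline{\mathcal L}'$ a set of lines of $\pi$ such that every point of $\pi$ not in $\overline{\mathcal P}'$ lies on exactly one line of $\overline{\mathcal L}'$ and every line of $\pi$ not in $\overline{\mathcal L}'$ contains exactly one point of $\overline{\mathcal P}'$. Define \[\overline{\mathcal P}=\{P\}\cup\overline{\mathcal P}'\cup\{X\in\mathcal P: X^\perp\cap\pi\in\overline{\mathcal L}'\},\qquad \overline{\mathcal L}=\{\ell\in\mathcal L: P\in\ell\}\cup\{\ell\in\mathcal L: \ell\not\subseteq\pi,\ \ell\cap\pi\in\overline{\mathcal P}'\}.\] Then $(\overline{\mathcal P},\overline{\mathcal L})$ is a $1$-good structure in $W(3,q)$. Moreover, if $P\in\overline{\mathcal P}'$ then $|\overline{\mathcal P}|=q|\overline{\mathcal P}'|+1$, and if $P\notin\overline{\mathcal P}'$ then $|\overline{\mathcal P}|=q|\overline{\mathcal P}'|+q+1$.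
   Context: $W(3,q)$: points are all points of $\mathrm{PG}(3,q)$ and lines are the totally isotropic lines with respect to the form; it is a generalized quadrangle of order $q$. The polarity $\perp$ maps a subspace $S$ to $S^\perp=\{Y:\beta(X,Y)=0\text{ for all }X\in S\}$, where $\beta$ is the form. A $1$-good structure in $W(3,q)$ is a pair $\overline{\mathcal P}\subseteq\mathcal P$, $\overline{\mathcal L}\subseteq\mathcal L$ such that every point of $W(3,q)$ not in $\overline{\mathcal P}$ lies on exactly one line of $\overline{\mathcal L}$ and every line of $W(3,q)$ not in $\overline{\mathcal L}$ contains exactly one point of $\overline{\mathcal P}$. *)

(* Defs.v *)
From HB Require Import structures.
From mathcomp Require Import all_boot all_order all_algebra.

Set Implicit Arguments.
Unset Strict Implicit.
Unset Printing Implicit Defensive.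

Import GRing.Theory.
Local Open Scope ring_scope.

(* Over a finite field a space has finitely many subspaces: {vspace V} is a   *)
(* subtype of a type of square matrices over F. This gives {set {vspace V}}   *)
(* and cardinals of sets of subspaces.                                        *)
Section VspaceFinite.
Import VectorInternalTheory.
Variables (F : finFieldType) (V : vectType F).
HB.instance Definition _ := [Countable of {vspace V} by <:].
HB.instance Definition _ := [Finite of {vspace V} by <:].
End VspaceFinite.

Section Geometry.

Variables (F : finFieldType) (V : vectType F).
Implicit Types U X l : {vspace V}.

(* The projective space PG(U): dimensions below are vector space dimensions,  *)
(* one more than the projective ones, and incidence is inclusion.             *)
Definition pg_points U := [set X : {vspace V} | (X <= U)%VS & \dim X == 1%N].
Definition pg_lines U := [set l : {vspace V} | (l <= U)%VS & \dim l == 2%N].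

Definition one_good (Pts Lns P' L' : {set {vspace V}}) : Prop :=
  [/\ P' \subset Pts,
      L' \subset Lns,
      {in Pts :\: P', forall X, #|[set l in L' | (X <= l)%VS]| = 1%N}
    & {in Lns :\: L', forall l, #|[set X in P' | (X <= l)%VS]| = 1%N}].

Variable beta : {skew_symmetric V}.

(* For V of dimension 4 and beta satisfying is_psymplectic these are the      *)
(* points and lines of W(3, #|F|). A skew-symmetric form is alternating only  *)
(* if the characteristic is not 2; is_psymplectic requires it separately in   *)
(* characteristic 2. The library's orthov beta l is the left orthogonal of l, *)
(* equal to the right one because beta is skew.                               *)
Definition W_points := pg_points {: V}.
Definition W_lines := [set l in pg_lines {: V} | (l <= orthov beta l)%VS].

(* When X = P, the space orthov beta X :&: orthov beta P is the whole plane   *)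
(* orthov beta P, hence not in a set L' of lines.                             *)
Definition ext_points (P : {vspace V}) (P' L' : {set {vspace V}}) :=
  [set P] :|: P'
  :|: [set X in W_points | (orthov beta X :&: orthov beta P)%VS \in L'].

Definition ext_lines (P : {vspace V}) (P' : {set {vspace V}}) :=
  [set l in W_lines | (P <= l)%VS]
  :|: [set l in W_lines | ~~ (l <= orthov beta P)%VS
                        & (l :&: orthov beta P)%VS \in P'].

End Geometry.

(* Main.v *)
(* Let pi = P^perp. Orthogonality sends a point X <> P to the line X^perp :&: pi
   of pi and a totally isotropic line l not through P to the point l :&: pi.
   For X outside pi, the totally isotropic lines through X correspond to the
   points of X^perp :&: pi; for l not through P, the points of l correspond to
   the lines of pi through l :&: pi. The two exact-cover conditions in W(3,q)
   are thus those of pi with points and lines exchanged. For the cardinals,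
   each line of L' is X^perp :&: pi for exactly q points X, and |P'| = |L'|. *)

Require Import Defs.
From mathcomp Require Import all_boot all_order all_algebra.
From mathcomp Require Import zify.

Set Implicit Arguments.
Unset Strict Implicit.
Unset Printing Implicit Defensive.

(** * Dimension counts for points, lines and hyperplanes *)

Section Subspaces.

Import GRing.Theory.
Local Open Scope ring_scope.

Variables (F : fieldType) (V : vectType F).
Implicit Types U W X Y l : {vspace V}.

Lemma subv_dim_eq U W : (U <= W)%VS -> (\dim W <= \dim U)%N -> U = W.
Proof. by move=> sUW dWU; apply/eqP; rewrite eqEdim sUW. Qed.

Lemma dimv1P X : \dim X = 1%N -> exists2 u, u != 0 & X = <[u]>%VS.
Proof.
move=> dX; have nz : vpick X != 0.
  by rewrite vpick0; apply: contra_eq_neq dX => ->; rewrite dimv0.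
exists (vpick X) => //; apply/esym/subv_dim_eq; first exact: memv_pick.
by rewrite dX dim_vline nz.
Qed.

Lemma dim1_cap0 X U : \dim X = 1%N -> ~~ (X <= U)%VS -> (X :&: U = 0)%VS.
Proof.
move=> dX nXU; apply/eqP; rewrite -dimv_eq0; apply: contraNT nXU => d0.
have /capv_idPl -> // : (X :&: U)%VS = X.
by apply: subv_dim_eq; [exact: capvSl | rewrite dX; lia].
Qed.

Lemma dim1_add X U :
  \dim X = 1%N -> ~~ (X <= U)%VS -> \dim (X + U) = (\dim U).+1.
Proof.
move=> dX nXU; have := dimv_sum_cap X U.
by rewrite (dim1_cap0 dX nXU) dimv0 dX; lia.
Qed.

Lemma dim1_neq X Y :
  \dim X = 1%N -> \dim Y = 1%N -> X != Y -> ~~ (X <= Y)%VS.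
Proof.
move=> dX dY; apply: contraNN => sXY.
by apply/eqP/subv_dim_eq; rewrite ?dX ?dY.
Qed.

Lemma dim_cap_hyperplane l U :
  \dim U = (\dim {:V}).-1 -> \dim l = 2%N -> ~~ (l <= U)%VS ->
  \dim (l :&: U) = 1%N.
Proof.
move=> dU dl nlU; have := dimv_sum_cap l U.
have := dimvS (subvf (l + U)); have := dimvS (subvf l).
have : (\dim (l :&: U) < 2)%N.
  rewrite ltnNge -dl; apply: contra nlU => d2.
  by apply/capv_idPl/subv_dim_eq; first exact: capvSl.
by lia.
Qed.

End Subspaces.

Lemma double_count (T1 T2 : finType) (r : T1 -> T2 -> bool)
    (A : {set T1}) (B : {set T2}) :
  \sum_(x in A) #|[set y in B | r x y]| = \sum_(y in B) #|[set x in A | r x y]|.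
Proof.
under eq_bigr do rewrite -sum1dep_card big_mkcondr.
rewrite exchange_big; apply: eq_bigr => y _.
by rewrite -sum1dep_card big_mkcondr.
Qed.

(** * Counting points and lines in a projective line and a projective plane *)

Section Plane.

Import GRing.Theory.
Local Open Scope ring_scope.

Variables (F : finFieldType) (V : vectType F).
Implicit Types U X Y l m : {vspace V}.

(** With [u], [v] a basis of [l], its points are the spans of [u + a *: v] for [a] in [F], and that
    of [v]. They are indexed by [option F], with [None] for the last one. *)
Lemma card_pg_points_line l : \dim l = 2%N -> #|pg_points l| = #|F|.+1.
Proof.
move=> dl; have [u [v [ul vl u0 vu]]] : exists u v,
    [/\ u \in l, v \in l, u != 0 & v \notin <[u]>%VS].
  have u0 : vpick l != 0.
    by rewrite vpick0; apply: contra_eq_neq dl => ->; rewrite dimv0.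
  have /subvPn [v vl vu] : ~~ (l <= <[vpick l]>)%VS.
    by apply/negP => /dimvS; rewrite dl dim_vline u0.
  by exists (vpick l), v; rewrite memv_pick.
have comb a b : a *: u + b *: v = 0 -> b = 0.
  move=> /eqP; rewrite addrC addr_eq0 => /eqP E; apply: contraNeq vu => b0.
  rewrite -[v]scale1r -(mulVf b0) -scalerA E.
  by rewrite memvZ ?memvN ?memvZ ?memv_line.
have uv0 a : u + a *: v != 0.
  apply: contra_neq u0 => E; have a0 := comb 1 a; move: E a0.
  by rewrite scale1r => E /(_ E) a0; rewrite a0 scale0r addr0 in E.
pose f o := if o is Some a then <[u + a *: v]>%VS else <[v]>%VS.
have v0 : v != 0 by apply: contraNneq vu => ->; rewrite mem0v.
have f_inj : injective f.
  have fP a k : u + a *: v = k *: v -> False.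
    move=> /(congr1 (+%R^~ (- (k *: v)))); rewrite subrr -addrA -scalerBl => E.
    have /comb E1 : 1 *: u + (a - k) *: v = 0 by rewrite scale1r.
    by move: E; rewrite E1 scale0r addr0 => /eqP; rewrite (negPf u0).
  move=> [a|] [b|] //= E.
  - have /vlineP [k Ek] : u + a *: v \in <[u + b *: v]>%VS.
      by rewrite -E memv_line.
    have E0 : (1 - k) *: u + (a - k * b) *: v = 0.
      rewrite !scalerBl addrACA -opprD -[k * b *: v]scalerA -scalerDr -Ek.
      by rewrite scale1r subrr.
    have E1 := comb _ _ E0; move: E0; rewrite E1 scale0r addr0 => /eqP.
    rewrite scaler_eq0 (negPf u0) orbF subr_eq0 => /eqP k1.
    by move: E1; rewrite -k1 mul1r => /eqP; rewrite subr_eq0 => /eqP ->.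
  - have /vlineP [k Ek] : u + a *: v \in <[v]>%VS by rewrite -E memv_line.
    by case: (fP _ _ Ek).
  - have /vlineP [k Ek] : u + b *: v \in <[v]>%VS by rewrite E memv_line.
    by case: (fP _ _ Ek).
have luv : (<[u]> + <[v]>)%VS = l.
  apply: subv_dim_eq; first by rewrite subv_add -!memvE ul vl.
  by rewrite addvC dim1_add ?dim_vline ?v0 ?u0 ?dl.
rewrite -card_option -cardsT -(card_imset _ f_inj); apply: eq_card => X.
rewrite !inE; apply/andP/imsetP => [[Xl /eqP /dimv1P [w w0 EX]]|[[a|] _ ->]].
- have : w \in l by apply: (subvP Xl); rewrite EX memv_line.
  rewrite -luv => /memv_addP [_ /vlineP [a ->] [_ /vlineP [b ->] Ew]].
  (* The generator is [a *: u + b *: v]: if [a] vanishes the point is the one at [None], otherwise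
     rescaling by the inverse of [a] gives the index [a^-1 * b]. *)
  have [a0|a0] := eqVneq a 0.
    exists None => //=; rewrite EX; apply: subv_dim_eq.
      by rewrite -memvE Ew a0 scale0r add0r memvZ // memv_line.
    by rewrite !dim_vline w0 v0.
  exists (Some (a^-1 * b)) => //=; rewrite EX; apply: subv_dim_eq.
    have -> : w = a *: (u + (a^-1 * b) *: v).
      by rewrite scalerDr scalerA mulrA divff // mul1r.
    by rewrite -memvE memvZ // memv_line.
  by rewrite !dim_vline w0 uv0.
- by rewrite /= dim_vline uv0 -memvE memvD ?memvZ.
- by rewrite /= dim_vline v0 -memvE vl.
Qed.

(** Projection from [Y]: if [n] is a complement of [Y] in [U], then [X + Y] and [l :&: n] are
    inverse maps between the points of the line [n] and the lines through [Y]. *)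
Lemma card_lines_through U Y : \dim U = 3%N -> Y \in pg_points U ->
  #|[set l in pg_lines U | (Y <= l)%VS]| = #|F|.+1.
Proof.
rewrite inE => dU /andP [YU /eqP dY].
pose n := (U :\: Y)%VS.
have nU : (n <= U)%VS by exact: diffvSl.
have nY : (Y :&: n = 0)%VS by rewrite capvC; exact: capv_diff.
have dn : \dim n = 2%N.
  by have := dimv_cap_compl U Y; rewrite (capv_idPr YU) dU dY /n; lia.
have YK X : (X <= n)%VS -> ((X + Y) :&: n)%VS = X.
  by move=> Xn; rewrite -vspace_modl // nY addv0.
have YNn : ~~ (Y <= n)%VS.
  by apply: contra_eqN nY => /capv_idPl ->; rewrite -dimv_eq0 dY.
have inj : {in pg_points n &, injective (fun X => X + Y)%VS}.
  move=> X X'; rewrite !inE => /andP[/YK E _] /andP[/YK E' _] EXX.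
  by rewrite -E -E' EXX.
rewrite -(card_pg_points_line dn) -(card_in_imset inj).
apply: eq_card => l; rewrite !inE.
apply/idP/imsetP => [/andP[/andP[lU /eqP dl] Yl]|[X]].
  have nln : ~~ (l <= n)%VS by apply: contra YNn; apply: subv_trans.
  have dln : \dim (l :&: n) = 1%N.
    have := dimv_sum_cap l n; rewrite dl dn.
    have : (\dim (l + n) <= 3)%N by rewrite -dU dimvS // subv_add lU.
    have : (\dim (l :&: n) < 2)%N.
      rewrite ltnNge -dl; apply: contra nln => d2.
      by apply/capv_idPl/subv_dim_eq; first exact: capvSl.
    by lia.
  exists (l :&: n)%VS; first by rewrite inE capvSr dln.
  apply/esym/subv_dim_eq; first by rewrite subv_add capvSl.
  rewrite addvC dim1_add ?dln ?dl //.
  by apply: contra YNn => /subv_trans; apply; exact: capvSr.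
rewrite inE => /andP[Xn /eqP dX] ->; rewrite addvSr subv_add YU.
rewrite (subv_trans Xn nU) addvC dim1_add ?dX //.
by apply: contra YNn => /subv_trans; apply.
Qed.

Lemma card_points_on_line U l : l \in pg_lines U ->
  #|[set X in pg_points U | (X <= l)%VS]| = #|F|.+1.
Proof.
rewrite inE => /andP[lU /eqP dl]; rewrite -(card_pg_points_line dl).
apply: eq_card => X; rewrite !inE andbC andbA.
by case Xl: (X <= l)%VS => //=; rewrite (subv_trans Xl lU).
Qed.

(** Incident pairs are counted twice: every point is on q+1 lines and every line has q+1 points. *)
Lemma card_pg_lines_plane U : \dim U = 3%N -> #|pg_lines U| = #|pg_points U|.
Proof.
move=> dU; have := double_count (fun X l => (X <= l)%VS)
  (pg_points U) (pg_lines U).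
rewrite (eq_bigr _ (fun X => @card_lines_through U X dU)).
rewrite (eq_bigr _ (@card_points_on_line U)) !sum_nat_const => /eqP.
by rewrite eqn_pmul2r // => /eqP.
Qed.

(* Both (q+1)|L'| + |P'| and (q+1)|P'| + |L'| equal the number of incidences
   between P' and L' plus the number of points, or lines, of the plane. *)
Lemma one_good_plane_card U (P' L' : {set {vspace V}}) : \dim U = 3%N ->
  one_good (pg_points U) (pg_lines U) P' L' -> #|P'| = #|L'|.
Proof.
move=> dU [sP sL gP gL].
pose r (X l : {vspace V}) := (X <= l)%VS.
have EL := double_count r (pg_points U) L'.
have EP := double_count r P' (pg_lines U).
have E := double_count r P' L'.
rewrite (eq_bigr _ (fun l Ll => card_points_on_line (subsetP sL l Ll))) in EL.
rewrite (eq_bigr _ (fun X PX => card_lines_through dU (subsetP sP X PX))) in EP.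
rewrite (big_setID P') (setIidPr sP) /= (eq_bigr _ gP) in EL.
rewrite [RHS](big_setID L') (setIidPr sL) /= (eq_bigr _ gL) in EP.
move: EL EP; rewrite E !sum_nat_const !cardsD (setIidPr sP) (setIidPr sL).
have := subset_leq_card sP; have := subset_leq_card sL.
rewrite card_pg_lines_plane // !muln1 !mulnS.
set e := (\sum_(y in L') _)%N; set pF := (_ * _)%N; set lF := (_ * _)%N.
set p := #|P'|. set n := #|_|. set l := #|_|.
move=> leL leP EL EP.
have /eqP : pF = lF by lia.
rewrite eqn_pmul2r; first by move/eqP.
by apply/card_gt0P; exists 0.
Qed.

End Plane.

(** * The symplectic polarity and dimensions of orthogonals *)

Section Polarity.

Import GRing.Theory.
Local Open Scope ring_scope.

Variables (F : fieldType) (V : vectType F) (beta : {skew_symmetric V}).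
Hypothesis beta_symplectic : is_psymplectic beta.
Implicit Types U W X Y l m : {vspace V}.

Let beta_nondeg : nondegenerate beta. Proof. by case: beta_symplectic. Qed.

(** Outside characteristic 2, skew-symmetry makes twice the value vanish; in characteristic 2 the
    claim is a clause of [is_psymplectic]. *)
Lemma psymplectic_alternating u : beta u u = 0.
Proof.
case: beta_symplectic => _ _ alt2.
have [/alt2 -> //|n2] := boolP (2%N \in [pchar F]).
have /eqP := hermC beta u u; rewrite /= expr1 mulN1r -addr_eq0 -mulr2n.
rewrite -mulr_natr mulf_eq0 => /orP [/eqP //|E].
by move: n2; rewrite inE /= E.
Qed.

Lemma orthovS U W : (U <= W)%VS -> (orthov beta W <= orthov beta U)%VS.
Proof. by move=> UW; rewrite orthov_sym (subv_trans UW) // -orthov_sym. Qed.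

Lemma orthov_add U W :
  orthov beta (U + W) = (orthov beta U :&: orthov beta W)%VS.
Proof.
apply/eqP; rewrite eqEsubv subv_cap !orthovS ?addvSl ?addvSr //=.
by rewrite orthovD capvSl capvSr.
Qed.

Lemma dim1_isotropic X : \dim X = 1%N -> (X <= orthov beta X)%VS.
Proof.
by move=> /dimv1P[u _ ->]; rewrite orthov11 psymplectic_alternating.
Qed.

(** Each vector of a basis of [U] imposes one linear condition, which lowers the dimension by at
    most one. *)
Lemma leq_dim_orthov U : (\dim {:V} - \dim U <= \dim (orthov beta U))%N.
Proof.
suff dim_perp_span s : (\dim {:V} - size s <= \dim (orthov beta <<s>>))%N.
  by have := dim_perp_span (vbasis U); rewrite size_tuple (span_basis (vbasisP U)).
elim: s => [|u s IH]; first by rewrite span_nil orthov0 subn0.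
rewrite span_cons orthov_add capvC /=.
by have := leq_dim_orthov1 beta u (orthov beta <<s>>); lia.
Qed.

(** The lower bounds for [U] and for a complement add up to the dimension of [V]. By nondegeneracy
    the two orthogonals meet in 0, so neither bound can be strict. *)
Lemma dim_orthov U : \dim (orthov beta U) = (\dim {:V} - \dim U)%N.
Proof.
apply/eqP; rewrite eqn_leq leq_dim_orthov andbT.
have := leq_dim_orthov U^C; rewrite dimv_compl.
have := dimv_sum_cap (orthov beta U) (orthov beta U^C).
rewrite -orthov_add addv_complf (eqP beta_nondeg) dimv0.
have := dimvS (subvf (orthov beta U + orthov beta U^C)).
by have := dimvS (subvf U); lia.
Qed.

End Polarity.

(** * The plane [pi] and the totally isotropic lines *)

Section Extension.

Import GRing.Theory.
Local Open Scope ring_scope.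

Variables (F : finFieldType) (V : vectType F) (beta : {skew_symmetric V}).
Hypotheses (dim_V : \dim {:V} = 4%N) (beta_symplectic : is_psymplectic beta).
Variable P : {vspace V}.
Hypothesis dim_P : \dim P = 1%N.
Implicit Types X Y l m : {vspace V}.

Local Notation perp := (orthov beta).
Local Notation pi := (orthov beta P).

Lemma dim_pi : \dim pi = 3%N.
Proof. by rewrite dim_orthov // dim_V dim_P. Qed.

Lemma point_in_pi : (P <= pi)%VS.
Proof. exact: dim1_isotropic. Qed.

Lemma dim_perp_cap_pi X : \dim X = 1%N -> X != P -> \dim (perp X :&: pi) = 2%N.
Proof.
move=> dX XP; rewrite -orthov_add dim_orthov // dim_V.
by rewrite dim1_add ?dim_P ?dim1_neq.
Qed.

(** Both sides of the equality have dimension 2, so one inclusion suffices. The points sent to [m]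
    are thus those of [perp m] other than [P]. *)
Lemma perp_cap_piE X m : \dim X = 1%N -> X != P -> m \in pg_lines pi ->
  ((perp X :&: pi)%VS == m) = (X <= perp m)%VS.
Proof.
rewrite inE => dX XP /andP[mpi /eqP dm]; rewrite orthov_sym.
apply/eqP/idP => [<-|mX]; first exact: capvSl.
by apply/esym/subv_dim_eq; rewrite ?subv_cap ?mX // dim_perp_cap_pi ?dm.
Qed.

(** Since [X] and [P] are orthogonal, [X + P] is totally isotropic, hence contained in its own
    orthogonal, which has the same dimension. *)
Lemma perp_cap_pi_in X : \dim X = 1%N -> (X <= pi)%VS -> X != P ->
  (perp X :&: pi)%VS = (X + P)%VS.
Proof.
move=> dX Xpi XP; apply/esym/subv_dim_eq.
  by rewrite -orthov_add orthovD !subv_add !dim1_isotropic // Xpi orthov_sym Xpi.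
by rewrite dim_perp_cap_pi // dim1_add ?dim_P ?dim1_neq.
Qed.

Lemma in_W_lines l :
  (l \in W_lines beta) = (\dim l == 2%N) && (l <= perp l)%VS.
Proof. by rewrite !inE subvf. Qed.

(** A line has half the dimension of [V], so its inclusion in its orthogonal is an equality. *)
Lemma perp_W_line l : l \in W_lines beta -> perp l = l.
Proof.
rewrite in_W_lines => /andP[/eqP dl lI].
by apply/esym/subv_dim_eq; rewrite // dim_orthov // dim_V dl.
Qed.

Lemma dim_W_line l : l \in W_lines beta -> \dim l = 2%N.
Proof. by rewrite in_W_lines => /andP[/eqP ->]. Qed.

Lemma W_line_subpi l : l \in W_lines beta -> (l <= pi)%VS = (P <= l)%VS.
Proof. by move=> /perp_W_line pl; rewrite orthov_sym pl. Qed.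

Lemma join_W_line X Y : \dim X = 1%N -> \dim Y = 1%N -> X != Y ->
  (X <= perp Y)%VS -> (X + Y)%VS \in W_lines beta.
Proof.
move=> dX dY XY XpY; rewrite in_W_lines dim1_add ?dY ?dim1_neq //=.
by rewrite orthovD !subv_add !dim1_isotropic // XpY orthov_sym XpY.
Qed.

(** * The extended structure: the two cover conditions and the number of points *)

Variables P' L' : {set {vspace V}}.
Hypothesis good' : one_good (pg_points pi) (pg_lines pi) P' L'.

Local Notation S := [set X in W_points V | (perp X :&: pi)%VS \in L'].
Local Notation EP := (ext_points beta P P' L').
Local Notation EL := (ext_lines beta P P').

Lemma mem_P' X : X \in P' -> (X <= pi)%VS /\ \dim X = 1%N.
Proof.
by case: good' => /subsetP sP _ _ _ /sP; rewrite inE => /andP[? /eqP].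
Qed.

Lemma mem_L' l : l \in L' -> (l <= pi)%VS /\ \dim l = 2%N.
Proof.
by case: good' => _ /subsetP sL _ _ /sL; rewrite inE => /andP[? /eqP].
Qed.

Lemma in_ext_points X :
  (X \in EP) = [|| X == P, X \in P' | X \in S].
Proof. by rewrite in_setU in_setU1 orbA. Qed.

Lemma in_ext_lines l : (l \in EL) =
  (l \in W_lines beta) &&
  ((P <= l)%VS || ~~ (P <= l)%VS && ((l :&: pi)%VS \in P')).
Proof.
rewrite in_setU in_set [X in _ || X]in_set.
by case: (boolP (l \in _)) => //= /W_line_subpi ->.
Qed.

Lemma P_notin_S : P \notin S.
Proof.
rewrite !inE capvv; apply/negP => /andP[_ /mem_L'[_]].
by rewrite dim_pi.
Qed.

Lemma ext_points_sub : EP \subset W_points V.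
Proof.
apply/subsetP => X; rewrite in_ext_points !inE subvf /=.
by case/or3P => [/eqP ->|/mem_P'[_ ->] //|/andP[]//]; rewrite dim_P.
Qed.

Lemma ext_lines_sub : EL \subset W_lines beta.
Proof. by apply/subsetP => l; rewrite in_ext_lines => /andP[]. Qed.

(** A line of [EL] through [X] but not through [P] would have [X] as its trace on [pi], which is
    excluded because [X] is not in [P']. *)
Lemma ext_line_in_pi X : \dim X = 1%N -> (X <= pi)%VS -> X != P ->
  X \notin P' -> [set l in EL | (X <= l)%VS] = [set (X + P)%VS].
Proof.
move=> dX Xpi XP nXP'; have XPW := join_W_line dX dim_P XP Xpi.
apply/setP => l; rewrite in_set1 in_set in_ext_lines.
apply/idP/eqP => [|->]; last by rewrite XPW addvSl addvSr.
case/andP=> /andP[lW /orP[Pl|/andP[nPl lP']]] Xl.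
  apply/esym/subv_dim_eq; first by rewrite subv_add Xl.
  by rewrite (dim_W_line XPW) (dim_W_line lW).
case/negP: nXP'; suff -> : X = (l :&: pi)%VS by [].
apply: subv_dim_eq; first by rewrite subv_cap Xl.
by have [_ ->] := mem_P' lP'; rewrite dX.
Qed.

(* A totally isotropic line through a point X outside pi is X + Y with Y its
   trace on pi, and Y then lies on the line X^perp :&: pi. *)
Lemma card_ext_lines_off_pi X : \dim X = 1%N -> ~~ (X <= pi)%VS ->
  #|[set l in EL | (X <= l)%VS]|
  = #|[set Y in P' | (Y <= perp X :&: pi)%VS]|.
Proof.
(* Modular law, as [Y] lies in [pi] and [X] meets [pi] in 0. *)
move=> dX nXpi; have YK Y : Y \in P' -> ((X + Y) :&: pi)%VS = Y.
  move=> /mem_P'[Ypi _].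
  by rewrite addvC -vspace_modl // (dim1_cap0 dX) ?addv0.
have inj : {in [set Y in P' | (Y <= perp X :&: pi)%VS] &,
    injective (fun Y => X + Y)%VS}.
  move=> Y Z; rewrite !inE => /andP[/YK EY _] /andP[/YK EZ _] E.
  by rewrite -EY -EZ E.
rewrite -(card_in_imset inj); apply: eq_card => l.
rewrite in_set in_ext_lines; apply/idP/imsetP => [|[Y]].
  case/andP=> /andP[lW lP'] Xl.
  have nPl : ~~ (P <= l)%VS.
    by rewrite -W_line_subpi //; apply: contra nXpi; apply: subv_trans.
  move: lP'; rewrite nPl (negPf nPl) /= => lP'.
  exists (l :&: pi)%VS.
    by rewrite inE lP' capvS // -[X in (X <= _)%VS](perp_W_line lW) orthovS.
  apply/esym/subv_dim_eq; first by rewrite subv_add Xl capvSl.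
  have [_ dY] := mem_P' lP'.
  rewrite (dim_W_line lW) dim1_add ?dY //.
  by apply: contra nXpi => /subv_trans; apply; exact: capvSr.
rewrite inE subv_cap => /and3P[YP' YX Ypi] ->.
have [_ dY] := mem_P' YP'.
have XY : X != Y by apply: contraNneq nXpi => ->.
have XYW : (X + Y)%VS \in W_lines beta by rewrite join_W_line // orthov_sym.
by rewrite XYW addvSl YK // YP' -W_line_subpi // subv_add (negPf nXpi).
Qed.

(* The polarity maps the points of l bijectively onto the lines of pi through
   the point l :&: pi. *)
Lemma card_ext_points_on_line l : l \in W_lines beta -> l \notin EL ->
  #|[set X in EP | (X <= l)%VS]|
  = #|[set m in L' | (l :&: pi <= m)%VS]|.
Proof.
move=> lW; rewrite in_ext_lines lW negb_or /= => /andP[nPl].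
rewrite nPl /= => nlP'.
have nlpi : ~~ (l <= pi)%VS by rewrite W_line_subpi.
have dl := dim_W_line lW; have pl := perp_W_line lW.
have dY : \dim (l :&: pi) = 1%N.
  by apply: dim_cap_hyperplane; rewrite ?dim_pi ?dim_V.
have XnP X : (X <= l)%VS -> X != P by apply: contraTneq => ->.
pose f X := (perp X :&: pi)%VS.
have inj : {in [set X in EP | (X <= l)%VS] &, injective f}.
  move=> X Z; rewrite in_set => /andP[XE Xl]; rewrite in_set => /andP[ZE Zl] fE.
  have := subsetP ext_points_sub X XE; rewrite inE subvf => /eqP dX.
  have := subsetP ext_points_sub Z ZE; rewrite inE subvf => /eqP dZ.
  (* For distinct [X] and [Z], the common image lies in [perp X :&: perp Z = perp l = l], so it
     equals [l], which would then lie in [pi]. *)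
  apply: contraNeq nlpi => XZ.
  have XZl : (X + Z)%VS = l.
    by apply: subv_dim_eq; rewrite ?subv_add ?Xl // dim1_add ?dZ ?dl ?dim1_neq.
  have <- : f X = l; last exact: capvSr.
  apply: subv_dim_eq; last by rewrite dl dim_perp_cap_pi // XnP.
  by rewrite -pl -XZl orthov_add subv_cap capvSl fE capvSl.
rewrite -(card_in_imset inj); apply: eq_card => m.
apply/imsetP/idP => [[X]|].
  rewrite in_set in_ext_points => /andP[XE Xl] ->.
  have XY : (l :&: pi <= f X)%VS by rewrite capvS // -[X in (X <= _)%VS]pl orthovS.
  rewrite in_set XY andbT.
  move: XE; rewrite (negPf (XnP X Xl)) /= => /orP[XP'|]; last first.
    by rewrite inE => /andP[].
  (* This case is impossible: [X] would be the trace of [l] on [pi], which is not in [P']. *)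
  have [Xpi dX] := mem_P' XP'.
  case/negP: nlP'; suff <- : X = (l :&: pi)%VS by [].
  by apply: subv_dim_eq; rewrite ?dY ?dX // subv_cap Xl.
rewrite in_set => /andP[mL Ym].
have [mpi dm] := mem_L' mL.
have Ppm : (P <= perp m)%VS by rewrite orthov_sym.
have dpm : \dim (perp m) = 2%N by rewrite dim_orthov // dim_V dm.
(* The preimage of [m]: the lines [perp m] and [l] both lie in the plane [perp (l :&: pi)], so they
   meet; they differ because only the first contains [P]. *)
have dX : \dim (perp m :&: l) = 1%N.
  have := dimv_sum_cap (perp m) l; rewrite dpm dl.
  have : (\dim (perp m + l) <= 3)%N.
    have <- : \dim (perp (l :&: pi)) = 3%N by rewrite dim_orthov // dim_V dY.
    apply: dimvS; rewrite subv_add orthovS //.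
    by rewrite -[X in (X <= _)%VS]pl orthovS ?capvSl.
  have : (\dim (perp m :&: l) < 2)%N.
    rewrite ltnNge; apply: contra nPl => d2; apply: subv_trans Ppm _.
    by apply/capv_idPl/subv_dim_eq; rewrite ?capvSl ?dpm.
  by lia.
have fX : f (perp m :&: l)%VS = m.
  by apply/eqP; rewrite perp_cap_piE ?capvSl ?XnP ?capvSr // inE mpi dm.
exists (perp m :&: l)%VS => //.
rewrite in_set capvSr andbT in_ext_points; apply/or3P/Or33.
by rewrite !inE subvf dX -/(f _) fX.
Qed.

Lemma one_good_ext : one_good (W_points V) (W_lines beta) EP EL.
Proof.
have [_ _ goodP goodL] := good'.
split; [exact: ext_points_sub | exact: ext_lines_sub | |].
- move=> X; rewrite in_setD in_ext_points !negb_or => /andP[/and3P[XP XP' XS]].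
  rewrite inE subvf /= => /eqP dX.
  have [Xpi|nXpi] := boolP (X <= pi)%VS.
    by rewrite ext_line_in_pi ?cards1.
  (* As [X] is not in [S], the line [perp X :&: pi] is not in [L']. *)
  rewrite card_ext_lines_off_pi //; apply: goodL.
  by move: XS; rewrite in_setD !inE subvf dX capvSr dim_perp_cap_pi //= => ->.
- move=> l; rewrite in_setD => /andP[lE lW].
  rewrite card_ext_points_on_line //; apply: goodP.
  move: lE; rewrite in_ext_lines lW negb_or /= => /andP[nPl].
  rewrite nPl /= in_setD => ->; rewrite in_set capvSr.
  by rewrite dim_cap_hyperplane ?dim_pi ?dim_V ?(dim_W_line lW) ?W_line_subpi.
Qed.

(* The points X with X^perp :&: pi = m are the q points of m^perp other
   than P. *)
Lemma card_S : #|S| = (#|F| * #|L'|)%N.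
Proof.
rewrite mulnC -sum_nat_const -sum1_card.
rewrite (partition_big (fun X => perp X :&: pi)%VS (mem L')) /=; last first.
  by move=> X; rewrite in_set => /andP[].
apply: eq_bigr => m mL; have [mpi dm] := mem_L' mL.
have Ppm : (P <= perp m)%VS by rewrite orthov_sym.
have dpm : \dim (perp m) = 2%N by rewrite dim_orthov // dim_V dm.
have mE : m \in pg_lines pi by rewrite inE mpi dm.
have := card_pg_points_line dpm; rewrite (cardsD1 P) inE Ppm dim_P => -[<-].
rewrite sum1dep_card; apply: eq_card => X; rewrite in_setD1 !inE subvf /=.
have [->|XP] /= := eqVneq X P.
  have /negPf pim : pi != m by apply: contra_eq_neq dm => <-; rewrite dim_pi.
  by rewrite capvv pim andbF.
case: eqP => [dX|] /=; last by rewrite andbF.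
rewrite -perp_cap_piE // andbT.
by case: eqP => [->|]; rewrite ?mL ?andbF.
Qed.

(** A point [X] of [P'] other than [P] is already in [S]: the line [X + P] has two points in [P'],
    so it must belong to [L']. *)
Lemma card_ext_points_in : P \in P' -> #|EP| = (#|F| * #|P'| + 1)%N.
Proof.
move=> PP'; rewrite (one_good_plane_card dim_pi good') -card_S.
suff -> : EP = P |: S by rewrite cardsU1 P_notin_S addnC.
apply/setP => X; rewrite in_ext_points in_setU1.
have [//|XP] /= := eqVneq X P.
apply/orP/idP => [[XP'|//]|]; last by right.
have [Xpi dX] := mem_P' XP'.
rewrite !inE subvf dX /= perp_cap_pi_in //.
have [_ _ _ goodL] := good'.
have lE : (X + P)%VS \in pg_lines pi.
  by rewrite inE subv_add Xpi point_in_pi dim1_add ?dim_P ?dim1_neq.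
apply: contraT => nL.
have : [set X; P] \subset [set Y in P' | (Y <= X + P)%VS].
  apply/subsetP => Y; rewrite !inE => /orP[]/eqP ->.
    by rewrite XP' addvSl.
  by rewrite PP' addvSr.
by move/subset_leq_card; rewrite cards2 XP goodL // in_setD nL.
Qed.

(** Let [m] be the unique line of [L'] through [P]. A point of [P'] is in [S] exactly when it is on
    [m]. The set [T] of those off [m] has q elements, one on each of the q other lines of [pi]
    through [P], and [EP] is the disjoint union of [P], [T] and [S]. *)
Lemma card_ext_points_notin :
  P \notin P' -> #|EP| = (#|F| * #|P'| + #|F| + 1)%N.
Proof.
move=> nPP'; have [_ _ goodP goodL] := good'.
have Ppt : P \in pg_points pi by rewrite inE point_in_pi dim_P.
have /eqP/cards1P [m mE] : #|[set l in L' | (P <= l)%VS]| = 1%N.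
  by apply: goodP; rewrite in_setD nPP'.
have P'P X : X \in P' -> X != P by apply: contraTneq => ->.
have join_eq X n : X \in P' -> (X <= n)%VS -> (P <= n)%VS -> \dim n = 2%N ->
    (X + P)%VS = n.
  move=> XP' Xn Pn dn; have [_ dX] := mem_P' XP'.
  apply: subv_dim_eq; first by rewrite subv_add Xn.
  by rewrite dn dim1_add ?dim_P ?dim1_neq ?P'P.
have /andP[mL Pm] : (m \in L') && (P <= m)%VS.
  by have := set11 m; rewrite -mE in_set.
have [mpi dm] := mem_L' mL.
have m_uniq n : n \in L' -> (P <= n)%VS -> n = m.
  by move=> nL Pn; apply/set1P; rewrite -mE in_set nL.
pose T := [set X in P' | ~~ (X <= m)%VS].
pose B := [set n in pg_lines pi | (P <= n)%VS] :\ m.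
have cardB : #|B| = #|F|.
  have := card_lines_through dim_pi Ppt; rewrite (cardsD1 m).
  by rewrite in_set Pm inE mpi dm => -[].
have cardT : #|T| = #|F|.
  rewrite -cardB -!sum1_card; symmetry.
  transitivity (\sum_(n in B) #|[set X in T | (X <= n)%VS]|)%N.
    apply: eq_bigr => n; rewrite in_setD1 in_set => /and3P[nm nE Pn].
    have dn : \dim n = 2%N by move: nE; rewrite inE => /andP[_ /eqP].
    (* The line [n] is not in [L'], so it has one point in [P']; that point is off [m], since
       otherwise [n] and [m] would both be its join with [P]. *)
    rewrite -(goodL n).
      apply: eq_card => X; rewrite !inE; case XP': (X \in P') => //=.
      case Xn: (X <= n)%VS; rewrite ?andbF // andbT.
      symmetry; apply: contra nm => Xm.
      by rewrite -(join_eq X n) // (join_eq X m).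
    by rewrite in_setD nE andbT; apply: contra nm => /m_uniq ->.
  rewrite -(double_count (fun X n => X <= n)%VS); apply: eq_bigr => X.
  rewrite in_set => /andP[XP' nXm]; have [Xpi dX] := mem_P' XP'.
  apply/eqP/cards1P; exists (X + P)%VS; apply/setP => n; rewrite in_set1 in_set.
  rewrite in_setD1 in_set inE.
  apply/idP/eqP => [/andP[/and3P[_ /andP[_ /eqP dn] Pn] Xn]|->].
    by rewrite (join_eq X n).
  rewrite subv_add Xpi point_in_pi addvSl addvSr dim1_add ?dim_P ?dim1_neq ?P'P //.
  by rewrite !andbT; apply: contraNneq nXm => <-; exact: addvSl.
have P'S X : X \in P' -> (X \in S) = (X <= m)%VS.
  move=> XP'; have [Xpi dX] := mem_P' XP'.
  rewrite !inE subvf dX /= perp_cap_pi_in ?P'P //.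
  by apply/idP/idP => [/m_uniq <- | Xm]; rewrite ?addvSl ?addvSr // (join_eq X m).
have -> : EP = P |: (T :|: S).
  apply/setP => X; rewrite in_ext_points in_setU1 in_setU [X \in T]in_set.
  by case XP': (X \in P'); rewrite //= P'S // orNb.
have TS0 : T :&: S = set0.
  apply/setP => X; rewrite in_setI in_set0 [X \in T]in_set.
  by case XP': (X \in P'); rewrite // P'S // andNb.
rewrite cardsU1 in_setU (negPf P_notin_S) in_set (negPf nPP') /=.
rewrite cardsU TS0 cards0 subn0 cardT card_S (one_good_plane_card dim_pi good').
by rewrite addnC [(#|F| + _)%N]addnC.
Qed.

End Extension.

Theorem theorem4p1 (q : nat) (F : finFieldType) (card_F : #|F| = q)
    (V : vectType F) (dim_V : \dim {:V} = 4)
    (beta : {skew_symmetric V}%R) (beta_symplectic : is_psymplectic beta)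
    (P : {vspace V}) (P_point : P \in W_points V)
    (P' L' : {set {vspace V}})
    (good' : one_good (pg_points (orthov beta P)) (pg_lines (orthov beta P))
               P' L') :
  [/\ one_good (W_points V) (W_lines beta)
        (ext_points beta P P' L') (ext_lines beta P P'),
      P \in P' -> #|ext_points beta P P' L'| = q * #|P'| + 1
    & P \notin P' -> #|ext_points beta P P' L'| = q * #|P'| + q + 1].
Proof.
have dim_P : \dim P = 1 by move: P_point; rewrite inE => /andP[_ /eqP].
rewrite -card_F; split.
- exact: one_good_ext.
- exact: card_ext_points_in.
- exact: card_ext_points_notin.
Qed.
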